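(* Let $k,m,n$ be positive integers with $n\ge2$, $m\leqslant n/2$, and $t(m+j)=t(n+j)$ for all $0\leqslant j\leqslant k$. Then $$k\ll\sqrt n\,(\log n)^{3/2},$$ where the implied constant is absolute.
   Context: For $n\ge1$, $t(n)$ is the rooted planar tree of $n$: $t(1)$ is the single-vertex tree; if $n=p_1^{a_1}\cdots p_s^{a_s}$ with primes $p_1<\dots<p_s$ and $a_i\ge1$, then $t(n)$ is a root with $s$ edges ordered left to right, the $i$-th edge leading to a copy of $t(a_i)$. $f\ll g$ means $|f|\le Cg$. *)

(* Defs.v *)
From mathcomp Require Import all_boot.

Set Implicit Arguments.
Unset Strict Implicit.
Unset Printing Implicit Defensive.

Inductive planar_tree : Type := Node of seq planar_tree.

(* Recursion on fuel: each exponent of n is smaller than n, so n units suffice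
   for t(n), see factor_treeE; prime_decomp n lists the pairs (p_i, a_i) with
   p_1 < ... < p_s. *)
Fixpoint factor_tree_rec (fuel n : nat) : planar_tree :=
  if fuel is fuel'.+1 then
    Node [seq factor_tree_rec fuel' pa.2 | pa <- prime_decomp n]
  else Node [::].

Definition factor_tree (n : nat) : planar_tree := factor_tree_rec n n.

Lemma factor_tree_rec_fuel k l n :
  n <= k -> n <= l -> factor_tree_rec k n = factor_tree_rec l n.
Proof.
elim: k l n => [|k IHk] [|l] n //=; rewrite ?leqn0.
- by move=> /eqP-> _.
- by move=> _ /eqP->.
have [->|n_gt0] := posnP n; first by [].
move=> le_nk le_nl; congr Node; apply/eq_in_map => -[p a].
move=> /mem_prime_decomp[p_pr a_gt0 pa_n] /=.
have lt_an : a < n.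
  by apply: leq_trans (ltn_expl a (prime_gt1 p_pr)) (dvdn_leq n_gt0 pa_n).
by apply: IHk; rewrite -ltnS; apply: leq_trans lt_an _.
Qed.

Lemma factor_treeE n :
  0 < n -> factor_tree n = Node [seq factor_tree (logn p n) | p <- primes n].
Proof.
case: n => // n _; rewrite {1}/factor_tree /= prime_decompE -map_comp.
congr Node; apply/eq_in_map => p; rewrite mem_primes => /and3P[p_pr _ _] /=.
apply: factor_tree_rec_fuel => //; rewrite -ltnS.
apply: leq_trans (ltn_expl _ (prime_gt1 p_pr)) _.
exact: dvdn_leq (pfactor_dvdnn p n.+1).
Qed.

Lemma factor_tree1 : factor_tree 1 = Node [::].
Proof. by []. Qed.

(* Main.v *)
Require Import Defs.
From mathcomp Require Import all_boot all_order all_algebra.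
From mathcomp Require Import unstable reals exp.
From mathcomp Require Import zify ring lra.

Import Order.TTheory GRing.Theory Num.Theory.

Set Implicit Arguments.
Unset Strict Implicit.
Unset Printing Implicit Defensive.

(** The tree of [N] shows whether [N] is squarefree: all children of the root
    are then leaves. Put [D = n - m > 0] and let [p] be a prime with
    [p ^ 2] not dividing [D]. The [j <= k] with [p ^ 2 %| m + j] form a
    progression of about [l = k / p ^ 2] terms, along which every [n + j] must
    be divisible by [q ^ 2] for some prime [q <> p], [q <= b = sqrt (n + k)].
    Counting over [q] gives [l <= \sum_q (l / q ^ 2 + 1) <= 3 l / 4 + pi b],
    so [k] is at most about [4 p ^ 2 * pi b].
    Not every prime [p <= y] can satisfy [p ^ 2 %| D] once
    [\prod_(p <= y) p >= n], for which [y] of order [log n] suffices.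
    With Chebyshev's bound [pi b << b / log b] this gives
    [k << sqrt (n + k) * log n], hence even [k << sqrt n * log n]. *)

Lemma sqrtn_bounds n : exists b, b ^ 2 <= n < b.+1 ^ 2.
Proof.
elim: n => [|n [b /andP[le_n lt_n]]]; first by exists 0.
have [le_b|lt_b] := leqP (b.+1 ^ 2) n.+1; last by exists b; lia.
by exists b.+1; nia.
Qed.

Lemma sum_nat_leqb n t : \sum_(1 <= i < n.+1) (i <= t) = minn n t.
Proof.
elim: n => [|n IHn]; first by rewrite big_geq // min0n.
by rewrite big_nat_recr //= IHn; lia.
Qed.

(** * Binomial coefficients and their prime divisors *)

Lemma bin_leq_pow2 n k : 'C(n.+1, k) <= 2 ^ n.
Proof.
elim: n k => [|n IHn] [|k]; rewrite ?bin0 ?expn_gt0 //; first by case: k.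
by rewrite binS expnS mul2n -addnn leq_add.
Qed.

Lemma pow2_leq_bin_central n : 2 ^ n <= 'C(n.*2, n).
Proof.
elim: n => // n IHn.
have bin_sym : 'C(n.*2.+1, n.+1) = 'C(n.*2.+1, n).
  have le_n : n.+1 <= n.*2.+1 by lia.
  by rewrite -(bin_sub le_n); congr binomial; lia.
rewrite doubleS binS bin_sym expnS mul2n -addnn.
by apply: leq_add; apply: leq_trans IHn (leq_bin2l _ _).
Qed.

Lemma prime_dvdn_fact p n : prime p -> (p %| n`!) = (p <= n).
Proof.
move=> p_pr; apply/idP/idP => [|le_pn]; last by rewrite dvdn_fact ?prime_gt0.
elim: n => [|n IHn]; first by rewrite dvdn1 gtn_eqF ?prime_gt1.
by rewrite factS Euclid_dvdM // => /orP[/dvdn_leq|/IHn/leqW]; apply.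
Qed.

Lemma prime_dvdn_bin p n k :
  prime p -> k < p <= n -> n - k < p -> p %| 'C(n, k).
Proof.
move=> p_pr /andP[lt_kp le_pn] lt_nkp.
have le_kn : k <= n by apply: leq_trans le_pn; apply: ltnW.
have: p %| n`! by rewrite prime_dvdn_fact.
rewrite -(bin_fact le_kn) !Euclid_dvdM // !prime_dvdn_fact //.
by rewrite (leqNgt _ k) lt_kp (leqNgt _ (n - k)) lt_nkp !orbF.
Qed.

Lemma logn_fact_widen p n N : prime p -> n <= N ->
  logn p n`! = \sum_(1 <= i < N.+1) n %/ p ^ i.
Proof.
move=> p_pr le_nN; rewrite logn_fact // [RHS](big_cat_nat (n := n.+1)) //=.
rewrite [X in _ + X]big_nat [X in _ + X]big1 ?addn0 // => i /andP[lt_ni _].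
apply: divn_small; apply: ltn_trans lt_ni (ltn_expl i (prime_gt1 p_pr)).
Qed.

(* Kummer: the [i]-th term records the carry out of digit [i.-1] in base [p]. *)
Lemma logn_bin_addn p m n : prime p ->
  logn p 'C(m + n, m) =
    \sum_(1 <= i < (m + n).+1) (p ^ i <= m %% p ^ i + n %% p ^ i).
Proof.
move=> p_pr; have := bin_fact (leq_addr n m); rewrite addKn.
move/(congr1 (logn p)).
rewrite !lognM ?muln_gt0 ?fact_gt0 ?bin_gt0 ?leq_addr //.
rewrite !(@logn_fact_widen _ _ (m + n)) ?leq_addr ?leq_addl //.
under [X in _ = X -> _]eq_bigr => i _.
  by rewrite divnD ?expn_gt0 ?prime_gt0 //; over.
by rewrite !big_split /=; lia.
Qed.

Lemma logn_bin_leq p n k : prime p -> logn p 'C(n, k) <= trunc_log p n.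
Proof.
move=> p_pr; have p_gt1 := prime_gt1 p_pr.
have [lt_nk|le_kn] := ltnP n k; first by rewrite bin_small // logn0.
rewrite -[n](subnKC le_kn) logn_bin_addn //; set N := k + _.
apply: leq_trans (geq_minr N _); rewrite -sum_nat_leqb.
apply: leq_sum => i _; have [le_pi|//] := leqP (p ^ i); rewrite lt0b.
apply: trunc_log_max => //; apply: leq_trans le_pi _.
by rewrite leq_add ?leq_mod.
Qed.

Lemma prod_pfactor_logn n N : 0 < n -> {in primes n, forall p, p <= N} ->
  n = \prod_(1 <= p < N.+1 | prime p) p ^ logn p n.
Proof.
move=> n_gt0 le_primes; rewrite {1}(prod_prime_decomp n_gt0).
rewrite prime_decompE big_map /=.
have -> : primes n = [seq p <- index_iota 1 N.+1 | prime p & p \in primes n].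
  apply: (irr_sorted_eq ltn_trans ltnn) => [||p]; first exact: sorted_primes.
    by rewrite sorted_filter ?iota_ltn_sorted //; apply: ltn_trans.
  rewrite mem_filter mem_index_iota ltnS andbC.
  have [p_n|] := boolP (p \in primes n); last by rewrite !andbF.
  have:= p_n; rewrite mem_primes le_primes // => /andP[p_pr _].
  by rewrite prime_gt0 // p_pr.
rewrite big_filter big_mkcondr; apply: eq_bigr => p _.
by case: ifPn => //; rewrite -logn_gt0 -eqn0Ngt => /eqP->.
Qed.

(** * Chebyshev's bounds *)

Definition primorial n := \prod_(1 <= p < n.+1 | prime p) p.

Definition prime_pi n := \sum_(1 <= p < n.+1 | prime p) 1.

Lemma prod_prime_exp_dvdn (s : seq nat) a x :
    uniq s -> {in s, forall p, prime p -> p ^ a %| x} ->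
  (\prod_(p <- s | prime p) p) ^ a %| x.
Proof.
move=> s_uniq dvd_x.
rewrite (big_morph (expn^~ a) (fun u v => expnMn u v a) (exp1n a)).
apply/Gauss_dvd_prod => //; rewrite pairwise_map.
have prime_coprimeX : {in prime &, subrel [rel p q | p != q]
                                          (relpre (expn^~ a) coprime)}.
  move=> p q p_pr q_pr /= neq_pq; rewrite coprimeXl ?coprimeXr //.
  by rewrite prime_coprime // dvdn_prime2.
apply: (sub_in_pairwise prime_coprimeX); first exact: filter_all.
by rewrite -uniq_pairwise filter_uniq.
Qed.

Lemma primorial0 : primorial 0 = 1.
Proof. by rewrite /primorial big_geq. Qed.

Lemma primorialS n :
  primorial n.+1 = primorial n * (if prime n.+1 then n.+1 else 1).
Proof. by rewrite /primorial big_mkcond big_nat_recr //= -big_mkcond. Qed.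

Lemma primorial_cat m n : m <= n ->
  primorial n = primorial m * \prod_(m.+1 <= p < n.+1 | prime p) p.
Proof. by move=> le_mn; rewrite /primorial (big_cat_nat (n := m.+1)). Qed.

Lemma primorial_gt0 n : 0 < primorial n.
Proof. by apply: prodn_cond_gt0 => p; apply: prime_gt0. Qed.

Lemma prime_pi_leq n : prime_pi n <= n.
Proof.
by rewrite /prime_pi sum1_count (leq_trans (count_size _ _)) // size_iota subn1.
Qed.

Lemma prod_prime_leq_bin m :
  \prod_(m.+2 <= p < m.*2.+2 | prime p) p <= 'C(m.*2.+1, m).
Proof.
apply: dvdn_leq; first by rewrite bin_gt0; lia.
rewrite -[\prod_(_ <= _ < _ | _) _]expn1.
apply: prod_prime_exp_dvdn => [|p]; first exact: iota_uniq.
rewrite mem_index_iota expn1 => lt_p p_pr.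
by apply: prime_dvdn_bin => //; lia.
Qed.

Lemma primorial_leq_pow4 n : primorial n <= 4 ^ n.
Proof.
elim/ltn_ind: n => -[|n] IHn; first by rewrite primorial0.
have [n_odd|n_even] := boolP (odd n).
  have [->|n_neq1] := eqVneq n 1; first by rewrite !primorialS primorial0.
  rewrite primorialS ifN ?muln1.
    by apply: leq_trans (IHn n (leqnn _)) _; rewrite leq_exp2l.
  by apply/negP => /even_prime; rewrite /= n_odd; lia.
have [->|n_neq0] := eqVneq n 0; first by rewrite primorialS primorial0.
have -> : n = n./2.*2 by lia.
rewrite (@primorial_cat n./2.+1); last by lia.
apply: (@leq_trans (4 ^ n./2.+1 * 4 ^ n./2)).
  apply: leq_mul; first by apply: IHn; lia.
  apply: leq_trans (prod_prime_leq_bin _) _; rewrite -[4]/(2 ^ 2) -expnM mul2n.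
  exact: bin_leq_pow2.
by rewrite -expnD leq_exp2l //; lia.
Qed.

(* Each of the primes in [(2 ^ f, n]] contributes at least a factor [2 ^ f] to
   the primorial of [n]. *)
Lemma mul_prime_pi_leq f n : f * prime_pi n <= f * 2 ^ f + 2 * n.
Proof.
have [le_n|lt_n] := leqP n (2 ^ f).
  apply: leq_trans (leq_addr _ _); rewrite leq_mul2l.
  by rewrite (leq_trans (prime_pi_leq n)) ?orbT.
have le_n : (2 ^ f).+1 <= n.+1 by apply: ltnW.
rewrite /prime_pi (big_cat_nat (ltn0Sn _) le_n) /= mulnDr.
apply: leq_add; first by rewrite leq_mul2l prime_pi_leq orbT.
rewrite -(leq_exp2l (m := 2)) // [2 ^ (2 * n)]expnM.
apply: leq_trans (primorial_leq_pow4 n); rewrite (primorial_cat (ltnW lt_n)).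
rewrite -[leqLHS]mul1n; apply: leq_mul; first exact: primorial_gt0.
rewrite expnM expn_sum big_nat_cond [leqRHS]big_nat_cond.
by apply: leq_prod => p /andP[/andP[/ltnW le_fp _] _]; rewrite expn1.
Qed.

Lemma trunc_log2_prime_pi_leq n : trunc_log 2 n * prime_pi n <= 7 * n.
Proof.
have [->|n_gt0] := posnP n; first by rewrite trunc_log0.
pose f := (trunc_log 2 n)./2.
have f_def : trunc_log 2 n <= 2 * f + 1 <= (trunc_log 2 n).+1 by lia.
have le_fn : f * 2 ^ f <= n.
  have le_f : f <= 2 ^ f by apply: ltnW; apply: ltn_expl.
  apply: leq_trans (trunc_logP (isT : 1 < 2) n_gt0).
  apply: (@leq_trans (2 ^ f * 2 ^ f)); first by rewrite leq_mul2r le_f orbT.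
  by rewrite -expnD leq_exp2l //; lia.
have := mul_prime_pi_leq f n; have := prime_pi_leq n; nia.
Qed.

(* The primes [p > s] divide the binomial coefficient at most once. *)
Lemma bin_leq_primorial n k s : 0 < n -> n < s ^ 2 ->
  'C(n, k) <= n ^ s * primorial n.
Proof.
move=> n_gt0 lt_ns.
have [lt_nk|le_kn] := ltnP n k; first by rewrite bin_small.
have pfactor_leq p : prime p -> p ^ logn p 'C(n, k) <= n.
  move=> p_pr; apply: leq_trans (trunc_logP (prime_gt1 p_pr) n_gt0).
  by rewrite leq_exp2l ?prime_gt1 ?logn_bin_leq.
have primes_leq : {in primes 'C(n, k), forall p, p <= n}.
  move=> p p_C; have := p_C; rewrite mem_primes => /and3P[p_pr _ _].
  rewrite -logn_gt0 in p_C.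
  apply: leq_trans (pfactor_leq p p_pr).
  by rewrite -[leqLHS]expn1 leq_exp2l ?prime_gt1.
rewrite {1}(prod_pfactor_logn _ primes_leq) ?bin_gt0 //.
apply: (@leq_trans (\prod_(1 <= p < n.+1 | prime p) (n ^ (p <= s) * p))).
  apply: leq_prod => p p_pr; have [le_ps|lt_sp] := leqP p s.
    by rewrite -[leqLHS]muln1 leq_mul ?pfactor_leq ?prime_gt0.
  rewrite mul1n -[leqRHS]expn1 leq_exp2l ?prime_gt1 // -ltnS.
  rewrite -(ltn_exp2l _ _ (prime_gt1 p_pr)).
  by apply: leq_ltn_trans (pfactor_leq p p_pr) _; nia.
rewrite big_split leq_mul2r /= -expn_sum leq_pexp2l ?orbT //.
rewrite big_mkcond (leq_trans _ (geq_minr n s)) // -sum_nat_leqb.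
by apply: leq_sum => p _; case: ifP.
Qed.

(* With [N = a * n] and [s] of order [sqrt N], the factor [N ^ s] lost in the
   preceding lemma is at most [2 ^ (N / 2 - n)] once [a] is large; [a = 4 ^ 6]
   makes this true for every [n]. *)
Lemma pow2_leq_primorial : exists a, forall n, 2 ^ n <= primorial (a * n).
Proof.
exists (4 ^ 6) => n.
have [->|n_gt0] := posnP n; first by rewrite muln0 primorial0.
have [r /andP[le_rn lt_nr]] := sqrtn_bounds n.
have r_gt0 : 0 < r by case: r lt_nr {le_rn}; lia.
have N_def : (2 ^ 11 * n).*2 = 4 ^ 6 * n.
  by rewrite -mul2n mulnA -expnS -[4]/(2 ^ 2) -expnM.
have N_leq : 4 ^ 6 * n <= 2 ^ (12 + 2 * r).
  have lt_r := ltn_expl r (isT : 1 < 2).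
  rewrite -[4]/(2 ^ 2) -expnM expnD leq_mul2l /= mulnC expnM.
  by apply: leq_trans (ltnW lt_nr) _; rewrite leq_exp2r.
have N_lt : 4 ^ 6 * n < (2 ^ 6 * r.+1) ^ 2.
  by rewrite expnMn -expnM -[4]/(2 ^ 2) -expnM ltn_mul2l lt_nr expn_gt0.
have N_gt0 : 0 < 4 ^ 6 * n by rewrite muln_gt0 expn_gt0.
pose loss := (12 + 2 * r) * (2 ^ 6 * r.+1).
have loss_leq : loss + n <= 2 ^ 11 * n by rewrite /loss; nia.
have pow_gt0 : 0 < 2 ^ loss by rewrite expn_gt0.
rewrite -(leq_pmul2l pow_gt0) -expnD.
apply: (@leq_trans (2 ^ (2 ^ 11 * n))); first by rewrite leq_exp2l.
apply: leq_trans (pow2_leq_bin_central _) _; rewrite N_def.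
apply: leq_trans (bin_leq_primorial _ N_gt0 N_lt) _.
by rewrite leq_mul2r [leqRHS]expnM leq_exp2r ?N_leq ?orbT // muln_gt0 expn_gt0.
Qed.

(** * Squarefree numbers and their trees *)

(* [squarefree 0] holds, as [primes 0] is empty. *)
Definition squarefree n := all (fun p => ~~ (p ^ 2 %| n)) (primes n).

Lemma squarefreePn n : 0 < n ->
  reflect (exists2 p, prime p & p ^ 2 %| n) (~~ squarefree n).
Proof.
move=> n_gt0; apply: (iffP allPn) => [[p]|[p p_pr p2_n]].
  by rewrite mem_primes negbK => /andP[p_pr _]; exists p.
exists p; rewrite ?negbK // mem_primes p_pr n_gt0.
by apply: dvdn_trans p2_n; rewrite dvdn_exp.
Qed.

Definition is_leaf (t : planar_tree) := let: Node s := t in nilp s.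

Definition all_children_leaves (t : planar_tree) :=
  let: Node s := t in all is_leaf s.

Lemma is_leaf_factor_tree n : 0 < n -> is_leaf (factor_tree n) = (n == 1).
Proof.
move=> n_gt0; rewrite factor_treeE //= /nilp size_map size_eq0.
by rewrite primes_eq0 ltnNge; lia.
Qed.

Lemma all_children_leaves_factor_tree n : 0 < n ->
  all_children_leaves (factor_tree n) = squarefree n.
Proof.
move=> n_gt0; rewrite factor_treeE //= all_map; apply: eq_in_all => p /= p_n.
have := p_n; rewrite mem_primes => /and3P[p_pr _ _]; rewrite -logn_gt0 in p_n.
by rewrite is_leaf_factor_tree // pfactor_dvdn //; lia.
Qed.

Lemma factor_tree_eq_squarefree m n : 0 < m -> 0 < n ->
  factor_tree m = factor_tree n -> squarefree m = squarefree n.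
Proof.
by move=> m_gt0 n_gt0 eq_mn; rewrite -!all_children_leaves_factor_tree ?eq_mn.
Qed.

(** * Square divisors along progressions *)

Lemma sum_dvdn_progression q d a l : 0 < q -> coprime q d ->
  \sum_(i < l) (q %| a + d * i) <= l %/ q + 1.
Proof.
move=> q_gt0 co_qd.
have -> : \sum_(i < l) (q %| a + d * i) = #|[pred i : 'I_l | q %| a + d * i]|.
  rewrite -sum1_card [RHS]big_mkcond; apply: eq_bigr => i _.
  by rewrite inE; case: dvdn.
rewrite addn1 -[leqRHS]card_ord.
pose block (i : 'I_l) : 'I_((l %/ q).+1) := inord (i %/ q).
have blockE i : block i = i %/ q :> nat.
  by rewrite inordK // ltnS leq_div2r // ltnW.
apply: (@leq_card_in _ _ block) => i j; rewrite !inE => dvd_i dvd_j.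
move/(congr1 val); rewrite /= !blockE => eq_div.
wlog le_ij : i j dvd_i dvd_j eq_div / i <= j.
  by move=> le_case; case/orP: (leq_total i j) => le_ij;
    [|symmetry]; apply: le_case.
have: q %| d * (j - i) by rewrite mulnBr -(subnDl a) dvdn_sub.
rewrite Gauss_dvdr // -eqn_mod_dvd // => /eqP eq_mod; apply/val_inj.
by rewrite /= (divn_eq i q) eq_div -eq_mod -divn_eq.
Qed.

(* [\sum_(a < q <= n) 1 / q ^ 2 <= 1 / a - 1 / n], by telescoping. *)
Lemma leq_sum_divn_sqr l a n : a <= n ->
  a * n * \sum_(a.+1 <= q < n.+1) l %/ q ^ 2 <= l * (n - a).
Proof.
elim: n => [|n IHn]; first by rewrite leqn0 => /eqP->.
rewrite leq_eqVlt => /orP[/eqP->|]; first by rewrite big_geq ?muln0.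
rewrite ltnS => le_an; rewrite big_nat_recr //=.
have [n0|n_gt0] := posnP n; first by have -> : a = 0 by lia.
have := leq_divM l (n.+1 ^ 2).
move: (l %/ _) (\sum_(_ <= _ < _) _) (IHn le_an) => x t le_t le_x.
have le_nx : n * (n.+1 * x) <= l by nia.
have le_nt : n.+1 * (a * n * t) <= n.+1 * (l * (n - a)) by rewrite leq_mul2l.
have le_ax : a * (n * (n.+1 * x)) <= a * l by rewrite leq_mul2l le_nx orbT.
rewrite -(leq_pmul2l n_gt0) subSn //.
have sub_n := subnKC le_an; move: (n - a) sub_n le_nt => c sub_n le_nt.
have -> : n * (l * c.+1) = n.+1 * (l * c) + a * l by rewrite -sub_n; lia.
lia.
Qed.

(* Splitting off [q = 2] makes the constant [1 / 4 + 1 / 2] smaller than 1. *)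
Lemma sum_prime_divn_sqr l n :
  4 * (\sum_(1 <= q < n.+1 | prime q) l %/ q ^ 2) <= 3 * l.
Proof.
apply: (@leq_trans (4 * (l %/ 4 + \sum_(3 <= q < n.+3) l %/ q ^ 2))).
  rewrite leq_mul2l big_mkcond.
  apply: (@leq_trans (\sum_(1 <= q < n.+3) if prime q then l %/ q ^ 2 else 0)).
    have le_n : n.+1 <= n.+3 by lia.
    by rewrite [leqRHS](big_cat_nat (ltn0Sn n) le_n) leq_addr.
  rewrite 2?big_ltn // add0n leq_add2l.
  by apply: leq_sum => q _; case: ifP.
have := leq_sum_divn_sqr l (isT : 2 <= n.+2); have := leq_divM l 4.
move: (l %/ 4) (\sum_(_ <= _ < _) _) => x t; nia.
Qed.

Lemma sum_prime_sqr_dvdn_progression d a l b :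
  4 * (\sum_(1 <= q < b.+1 | prime q && coprime q d)
         \sum_(i < l) (q ^ 2 %| a + d * i)) <= 3 * l + 4 * prime_pi b.
Proof.
apply: leq_trans (_ : 4 * \sum_(1 <= q < b.+1 | prime q) (l %/ q ^ 2 + 1) <= _).
  rewrite leq_mul2l big_mkcondr; apply: leq_sum => q q_pr /=.
  case: ifP => // co_qd; apply: sum_dvdn_progression; last exact: coprimeXl.
  by rewrite expn_gt0 prime_gt0.
by rewrite big_split mulnDr leq_add2r sum_prime_divn_sqr.
Qed.

Lemma sqr_dvdn_progression_leq d a l b :
    (forall i, i < l -> 0 < a + d * i < b.+1 ^ 2) ->
    (forall i, i < l ->
       exists2 q, prime q && coprime q d & q ^ 2 %| a + d * i) ->
  l <= 4 * prime_pi b.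
Proof.
move=> term_bounds sqr_dvd.
have: l <= \sum_(1 <= q < b.+1 | prime q && coprime q d)
             \sum_(i < l) (q ^ 2 %| a + d * i).
  rewrite exchange_big -{1}[l]card_ord -sum1_card; apply: leq_sum => i _ /=.
  have /andP[term_gt0 term_lt] := term_bounds i (ltn_ord i).
  have [q q_cond q2_dvd] := sqr_dvd i (ltn_ord i).
  have q_gt0 : 0 < q by case/andP: q_cond => /prime_gt0.
  have lt_qb : q < b.+1.
    rewrite -(ltn_exp2r _ _ (isT : 0 < 2)); apply: leq_ltn_trans term_lt.
    exact: dvdn_leq q2_dvd.
  rewrite big_mkcond (bigD1_seq q) ?iota_uniq ?mem_index_iota ?q_gt0 //=.
  by rewrite q_cond q2_dvd.
have := sum_prime_sqr_dvdn_progression d a l b; lia.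
Qed.

Lemma exists_dvdn_addn d m : 0 < d -> exists2 j, j < d & d %| m + j.
Proof.
move=> d_gt0; exists ((d - m %% d) %% d); first by rewrite ltn_mod.
by rewrite /dvdn modnDmr -modnDml subnKC ?modnn // ltnW ?ltn_mod.
Qed.

(** * Runs of equal trees *)

Section EqualTrees.

Variables k m n b : nat.
Hypotheses (m_gt0 : 0 < m) (lt_mn : m < n) (lt_nkb : n + k < b.+1 ^ 2).
Hypothesis eq_tree :
  forall j, j <= k -> factor_tree (m + j) = factor_tree (n + j).

Lemma equal_trees_divn_sqr_leq p : prime p -> ~~ (p ^ 2 %| n - m) ->
  k %/ p ^ 2 <= 4 * prime_pi b.
Proof.
move=> p_pr p2_ndvd; have p2_gt0 : 0 < p ^ 2 by rewrite expn_gt0 prime_gt0.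
have [j lt_jp p2_mj] := exists_dvdn_addn m p2_gt0.
have le_k i : i < k %/ p ^ 2 -> j + p ^ 2 * i <= k.
  by rewrite -[_ < _]/(i.+1 <= _) leq_divRL // mulSn mulnC; lia.
apply: (@sqr_dvdn_progression_leq (p ^ 2) (n + j)) => i /le_k le_i.
  by lia.
have p2_mji : p ^ 2 %| m + (j + p ^ 2 * i).
  by rewrite addnA dvdn_add // dvdn_mulr.
have p2_nji : ~~ (p ^ 2 %| n + j + p ^ 2 * i).
  have -> : n + j + p ^ 2 * i = m + (j + p ^ 2 * i) + (n - m) by lia.
  by rewrite dvdn_addr.
have nji_gt0 : 0 < n + j + p ^ 2 * i by lia.
have /(squarefreePn nji_gt0)[q q_pr q2_nji] : ~~ squarefree (n + j + p ^ 2 * i).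
  rewrite -addnA -(factor_tree_eq_squarefree _ _ (eq_tree le_i)); try lia.
  by apply/squarefreePn; [lia | exists p].
exists q => //; rewrite q_pr coprimeXr // prime_coprime // dvdn_prime2 //.
by apply: contraNneq p2_nji => eq_qp; rewrite eq_qp in q2_nji.
Qed.

Lemma equal_trees_leq y : n <= primorial y -> k < (4 * prime_pi b + 1) * y ^ 2.
Proof.
move=> le_ny.
have y_gt0 : 0 < y by case: y le_ny => //; rewrite primorial0; lia.
rewrite -ltn_divLR ?expn_gt0 ?y_gt0 // addn1 ltnS leqNgt.
apply/negP => lt_k; have: primorial y ^ 2 %| n - m.
  apply: prod_prime_exp_dvdn => [|p]; first exact: iota_uniq.
  rewrite mem_index_iota => /andP[_ le_py] p_pr.
  apply: contraLR lt_k => /(equal_trees_divn_sqr_leq p_pr) le_kp.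
  rewrite -leqNgt; apply: leq_trans le_kp.
  by rewrite leq_div2l ?expn_gt0 ?prime_gt0 // leq_exp2r.
move/dvdn_leq; rewrite subn_gt0 => /(_ lt_mn); nia.
Qed.

End EqualTrees.

Lemma trunc_log2_mul_prime_pi_leq n b : 0 < n -> n < b.+1 ^ 2 ->
  (trunc_log 2 n).+1 * (4 * prime_pi b + 1) <= 66 * b.
Proof.
move=> n_gt0 lt_nb; have b_gt0 : 0 < b by case: b lt_nb; lia.
have log_b : (trunc_log 2 b).+1 <= b.
  by apply: leq_trans (ltn_expl _ (isT : 1 < 2)) (trunc_logP _ b_gt0).
have log_n : (trunc_log 2 n).+1 <= 2 * (trunc_log 2 b).+1.
  rewrite -(ltn_exp2l _ _ (isT : 1 < 2)) mulnC expnM.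
  apply: leq_ltn_trans (trunc_logP _ n_gt0) (leq_trans lt_nb _) => //.
  by rewrite leq_exp2r // trunc_log_ltn.
have := trunc_log2_prime_pi_leq b; have := prime_pi_leq b; nia.
Qed.

Lemma equal_trees_sqr_leq : exists a, forall k m n, 0 < m -> m < n ->
    (forall j, j <= k -> factor_tree (m + j) = factor_tree (n + j)) ->
  k ^ 2 <= (a * (trunc_log 2 n).+1) ^ 2 * (n + k).
Proof.
have [a pow2_leq] := pow2_leq_primorial.
exists (66 * a ^ 2) => k m n m_gt0 lt_mn.
set e := (trunc_log 2 n).+1 => eq_tree.
have n_gt0 : 0 < n by lia.
have [b /andP[le_b lt_b]] := sqrtn_bounds (n + k).
have lt_nb : n < b.+1 ^ 2 by apply: leq_ltn_trans lt_b; apply: leq_addr.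
have le_n : n <= primorial (a * e).
  by apply: leq_trans (pow2_leq e); apply/ltnW/trunc_log_ltn.
have lt_k := equal_trees_leq m_gt0 lt_mn lt_b eq_tree le_n.
have le_k : k <= 66 * a ^ 2 * e * b.
  apply: leq_trans (ltnW lt_k) _.
  have -> : (4 * prime_pi b + 1) * (a * e) ^ 2 =
              a ^ 2 * e * (e * (4 * prime_pi b + 1)) by rewrite expnMn; lia.
  have -> : 66 * a ^ 2 * e * b = a ^ 2 * e * (66 * b) by lia.
  by rewrite leq_mul2l trunc_log2_mul_prime_pi_leq ?orbT.
apply: (@leq_trans ((66 * a ^ 2 * e * b) ^ 2)); first by rewrite leq_exp2r.
by rewrite expnMn leq_mul2l le_b orbT.
Qed.

Local Open Scope ring_scope.

Lemma ler_sqr_mulD (R : rcfType) (a x y : R) : 0 <= a -> 0 <= y ->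
  x ^+ 2 <= a ^+ 2 * (y + x) -> x <= a * (Num.sqrt y + a).
Proof.
move=> a_ge0 y_ge0; rewrite -{1}(sqr_sqrtr y_ge0).
move: (Num.sqrt y) (sqrtr_ge0 y) => s s_ge0 le_x2; rewrite leNgt.
apply/negP => lt_x.
have as_ge0 := mulr_ge0 a_ge0 s_ge0.
have as_lt : a * s < x - a ^+ 2 by lra.
have : (a * s) ^+ 2 < x * (x - a ^+ 2) by nra.
by rewrite exprMn; lra.
Qed.

Lemma ln2_ge_half (R : realType) : 2^-1 <= ln 2 :> R.
Proof.
have := @le_ln1Dx R (- 2^-1); have -> : 1 - 2^-1 = 2^-1 :> R by lra.
by rewrite lnV ?posrE // lerN2; apply; lra.
Qed.

Lemma trunc_log2_ler_ln (R : realType) n : (2 <= n)%N ->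
  (trunc_log 2 n).+1%:R <= 4 * ln n%:R :> R.
Proof.
move=> n_ge2; have n_gt0 : (0 < n)%N by lia.
set t := trunc_log 2 n.
have t_ge1 : 1 <= t%:R :> R by rewrite ler1n trunc_log_gt0.
have: ln (2 ^+ t) <= ln n%:R :> R.
  by rewrite ler_ln ?posrE ?exprn_gt0 ?ltr0n // -natrX ler_nat trunc_logP.
rewrite lnXn // -[ln 2 *+ t]mulr_natr -natr1 => le_t.
have : 2^-1 * t%:R <= ln 2 * t%:R :> R.
  by rewrite ler_wpM2r ?ln2_ge_half ?ler0n.
by lra.
Qed.

Lemma ln_ler_sqrt (R : realType) (x : R) : 0 < x -> ln x <= 2 * Num.sqrt x.
Proof.
move=> x_gt0; rewrite -{1}(sqr_sqrtr (ltW x_gt0)) lnXn ?sqrtr_gt0 //.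
rewrite -[leLHS]mulr_natl ler_wpM2l //.
by apply/ltW/ln_sublinear; rewrite sqrtr_gt0.
Qed.

Lemma powRB1_mul_ler (R : realType) (a x p : R) : 0 <= a <= x -> 1 < p ->
  a `^ (p - 1) * x <= x `^ p.
Proof.
move=> /andP[a_ge0 le_ax] p_gt1; have x_ge0 := le_trans a_ge0 le_ax.
rewrite -(mulr_powRB1 x_ge0); last by lra.
by rewrite mulrC ler_wpM2l // ge0_ler_powR ?nnegrE //; lra.
Qed.

Lemma equal_trees_ler_sqrt_ln (R : realType) :
  exists C : R, 0 < C /\ forall k m n : nat, (0 < m < n)%N ->
      (forall j, (j <= k)%N -> factor_tree (m + j) = factor_tree (n + j)) ->
    k%:R <= C * (Num.sqrt n%:R * ln n%:R).
Proof.
have [a sqr_leq] := equal_trees_sqr_leq; pose c : R := 4 * a%:R + 1.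
have a_ge0 : 0 <= a%:R :> R by [].
have c_gt0 : 0 < c by rewrite /c; lra.
exists (c * (1 + 2 * c)).
split=> [|k m n /andP[m_gt0 lt_mn] eq_tree]; first by nra.
have n_ge2 : (2 <= n)%N by lia.
have n_gt0 : 0 < n%:R :> R by rewrite ltr0n; lia.
have le_e := trunc_log2_ler_ln R n_ge2; have le_ln := ln_ler_sqrt n_gt0.
have ln_ge0 : 0 <= ln n%:R :> R by rewrite ln_ge0 // ler1n; lia.
have le_ae : a%:R * (trunc_log 2 n).+1%:R <= c * ln n%:R :> R.
  by rewrite /c; nra.
have: k%:R ^+ 2 <= (c * ln n%:R) ^+ 2 * (n%:R + k%:R) :> R.
  apply: (@le_trans _ _ ((a%:R * (trunc_log 2 n).+1%:R) ^+ 2 * (n%:R + k%:R))).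
    by rewrite -natrM -natrD -!natrX -natrM ler_nat (sqr_leq _ m).
  by rewrite ler_wpM2r ?addr_ge0 // lerXn2r ?nnegrE ?mulr_ge0 // ltW.
have cln_ge0 : 0 <= c * ln n%:R by rewrite mulr_ge0 // ltW.
move/ler_sqr_mulD => le_k; apply: le_trans (le_k _ _) _ => //.
have -> : c * (1 + 2 * c) * (Num.sqrt n%:R * ln n%:R) =
    c * ln n%:R * (Num.sqrt n%:R + c * (2 * Num.sqrt n%:R)) by ring.
by rewrite ler_wpM2l // lerD2l ler_wpM2l // ltW.
Qed.

Theorem theorem11 (R : realType) :
  exists C : R, 0 < C /\
    forall k m n : nat,
      (0 < k)%N -> (0 < m)%N -> (2 <= n)%N ->
      m%:R <= n%:R / 2 :> R ->
      (forall j : nat, (j <= k)%N ->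
         factor_tree (m + j)%N = factor_tree (n + j)%N) ->
      k%:R <= C * (Num.sqrt n%:R * ln n%:R `^ (3 / 2)).
Proof.
have [C [C_gt0 k_leq]] := equal_trees_ler_sqrt_ln R.
have ln2_gt0 : 0 < ln 2 :> R by rewrite ln_gt0 // ltr1n.
pose w : R := ln 2 `^ (3 / 2 - 1); have w_gt0 : 0 < w by apply: powR_gt0.
exists (C / w); split=> [|k m n _ m_gt0 n_ge2 le_mn eq_tree].
  exact: divr_gt0.
have n_ge2R : 2 <= n%:R :> R by rewrite ler_nat.
have lt_mn : (0 < m < n)%N by rewrite m_gt0 -(ltr_nat R); lra.
apply: le_trans (k_leq k m n lt_mn eq_tree) _.
rewrite -mulrA ler_pM2l // mulrCA ler_wpM2l ?sqrtr_ge0 // ler_pdivlMl //.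
apply: powRB1_mul_ler; last by lra.
by rewrite ltW // ler_ln ?posrE //; lra.
Qed.
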